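(* Let $n\ge1$ and let $[\mathbf i_0]$ be a twisted adapted class of type $A_{2n+1}$ with coordinate map $\Omega_{[\mathbf i_0]}:\Phi^+\to I\times\tfrac12\mathbb Z$. Let $\beta\in\Phi^+$ with $\Omega_{[\mathbf i_0]}(\beta)=(i,p)$ and suppose $\alpha\in\Phi^+$ satisfies $\Omega_{[\mathbf i_0]}(\alpha)=(i,\,p-2+\delta_{i,n+1})$. Then $$\beta+\alpha=\sum_{\Omega_{[\mathbf i_0]}(\gamma)=(j,q)}\gamma ,$$ the sum being over all $\gamma\in\Phi^+$ whose coordinate is of the form $(j,q)$ with $$q=p-\frac{1}{1+\delta_{i,n+1}},\qquad j\in\begin{cases}\{n,\,n+3\}&\text{if } i=n+2,\\ \{n-1,\,n+2\}&\text{if } i=n,\\ \{i-1,\,i+1\}&\text{otherwise.}\end{cases}$$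
   Context: Let $I=\{1,\dots,2n+1\}$, $W$ the Weyl group of type $A_{2n+1}$ with simple reflections $s_i$, simple roots $\alpha_i$, positive roots $\Phi^+$, longest element $w_0$ of length $N$. Reduced words of $w_0$ are commutation equivalent if related by swapping neighbouring letters $i,j$ with $|i-j|\ge2$; $[\mathbf i]$ is the commutation class. An index $i$ is a sink (resp. source) of $[\mathbf i]$ if some word in the class starts (resp. ends) with $i$. With $i^*=2n+2-i$, reflection functors are: if $i$ is a sink and $i\,i_2\cdots i_N\in[\mathbf i]$, $[\mathbf i]r_i=[i_2\cdots i_N\,i^*]$; if $i$ is a source and $i_1\cdots i_{N-1}i\in[\mathbf i]$, $r_i[\mathbf i]=[i^*i_1\cdots i_{N-1}]$; otherwise the class is unchanged. Put $i^\vee=2n+2-i$; for a word, $(\cdot)^{k\vee}$ means applying $\vee$ letterwise $k$ times. A class is twisted adapted if it is obtained by a sequence of reflection functors from the class of the reduced word $\prod_{k=0}^{2n}(1\,2\cdots n{+}1)^{k\vee}$ of $w_0$. For a reduced word $\mathbf i_0=i_1\cdots i_N$ put $\beta_k=s_{i_1}\cdots s_{i_{k-1}}(\alpha_{i_k})$. The quiver $\Upsilon_{[\mathbf i_0]}$ has vertex set $\Phi^+=\{\beta_1,\dots,\beta_N\}$; $\beta_k$ has residue $i_k$; there is an arrow $\beta_k\to\beta_j$ iff $|i_k-i_j|=1$, $j=\max\{j'<k:i_{j'}=i_j\}$ and $k=\min\{k'>j:i_{k'}=i_k\}$. It depends only on $[\mathbf i_0]$. Coordinates. Let $P$ delete the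 letters $n+1$ from words in $I$ and replace each letter $j\ge n+2$ by $j-1$. For $[\mathbf i_0]$ twisted adapted there is a unique Dynkin quiver $Q$ of type $A_{2n}$ such that $P(\mathbf i_0)$ is a reduced word of the longest element of type $A_{2n}$ adapted to $Q$ (a word $j_1j_2\cdots$ is adapted to $Q$ if each $j_k$ is a sink of the quiver obtained from $Q$ by reversing successively all arrows at $j_1$, then at $j_2$, ..., then at $j_{k-1}$). Fix a height function $\xi$ on $Q$, i.e. $\xi(j)=\xi(i)+1$ whenever there is an arrow $i\to j$. The coordinate in $\Gamma_Q$ of the $k$-th occurrence (from the left) of a letter $i$ in $P(\mathbf i_0)$ is $(i,\xi(i)-2(k-1))$. Then $\Omega_{[\mathbf i_0]}$ is defined as follows: the $k$-th root of residue $i\le n$ in $\mathbf i_0$ (order $\beta_1,\beta_2,\dots$) has coordinate $(i,\xi(i)-2(k-1))$; the $k$-th root of residue $i\ge n+2$ has coordinate $(i,\xi(i-1)-2(k-1))$; a root of residue $n+1$ has coordinate $(n+1,p+\tfrac12)$ if in $\Upsilon_{[\mathbf i_0]}$ there is an arrow to it from a vertex with coordinate $(j,p)$, and $(n+1,p-\tfrac12)$ if there is an arrow from it to a vertex with coordinate $(j,p)$, $j\in\{n,n+2\}$ (these rules are consistent). *)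

(* Defs.v *)
From Stdlib Require Export Relation_Operators.
From mathcomp Require Export all_boot all_order all_algebra.

Set Implicit Arguments.
Unset Strict Implicit.
Unset Printing Implicit Defensive.

Import Order.TTheory GRing.Theory Num.Theory.
Local Open Scope ring_scope.

(* Letters and vertices are natural numbers numbered from 1, as in 1, ..., m;
   positions in a word are numbered from 0. *)

(* ** Type A_m, realized in Z^(m+1) with basis eps_1, ..., eps_(m+1) *)

Definition eps (m k : nat) : 'rV[int]_m.+1 := \row_(j < m.+1) (j.+1 == k)%:R.

Definition simple_root (m i : nat) : 'rV[int]_m.+1 := eps m i - eps m i.+1.

Definition pos_roots (m : nat) : seq 'rV[int]_m.+1 :=
  [seq eps m a - eps m b | a <- iota 1 m.+1, b <- iota a.+1 (m.+1 - a)].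

Definition dotv (m : nat) (u v : 'rV[int]_m.+1) : int :=
  \sum_(j < m.+1) u 0 j * v 0 j.

(* Simple roots have squared length 2, hence are their own coroots. *)
Definition simple_refl (m i : nat) (v : 'rV[int]_m.+1) : 'rV[int]_m.+1 :=
  v - dotv v (simple_root m i) *: simple_root m i.

(* The word i_1 ... i_k acts as s_{i_1} \o ... \o s_{i_k}. *)
Definition word_act (m : nat) (w : seq nat) (v : 'rV[int]_m.+1) :
    'rV[int]_m.+1 :=
  foldr (@simple_refl m) v w.

Definition word_over (m : nat) (w : seq nat) : bool :=
  all (fun i => (0 < i <= m)%N) w.

(* The Weyl group acts faithfully on Z^(m+1), so two words represent the same
   element iff they act in the same way. *)
Definition reduced (m : nat) (w : seq nat) : Prop :=
  word_over m w /\
  forall w' : seq nat, word_over m w' ->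
    @word_act m w' =1 @word_act m w -> (size w <= size w')%N.

(* w_0 is the unique element of maximal length. *)
Definition reduced_w0 (m : nat) (w : seq nat) : Prop :=
  reduced m w /\
  forall w' : seq nat, reduced m w' -> (size w' <= size w)%N.

(* ** Commutation classes and reflection functors *)

Definition far (i j : nat) : bool := (i + 2 <= j)%N || (j + 2 <= i)%N.

Definition adjacent (i j : nat) : bool := (i.+1 == j) || (j.+1 == i).

Inductive swap_step : seq nat -> seq nat -> Prop :=
  SwapStep (u v : seq nat) (i j : nat) :
    far i j -> swap_step (u ++ i :: j :: v) (u ++ j :: i :: v).

Definition commutation_equiv : seq nat -> seq nat -> Prop :=
  clos_refl_trans (seq nat) swap_step.

Definition is_sink (w : seq nat) (i : nat) : Prop :=
  exists u : seq nat, commutation_equiv w (i :: u).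

Definition is_source (w : seq nat) (i : nat) : Prop :=
  exists u : seq nat, commutation_equiv w (rcons u i).

(* i^* and i^\vee, which coincide in type A_(2n+1). *)
Definition star (n i : nat) : nat := (n.*2.+2 - i)%N.

(* [w] r_i = [w'] *)
Definition right_reflection (n i : nat) (w w' : seq nat) : Prop :=
  (exists u : seq nat, commutation_equiv w (i :: u) /\
                       commutation_equiv (rcons u (star n i)) w')
  \/ (~ is_sink w i /\ commutation_equiv w w').

(* r_i [w] = [w'] *)
Definition left_reflection (n i : nat) (w w' : seq nat) : Prop :=
  (exists u : seq nat, commutation_equiv w (rcons u i) /\
                       commutation_equiv (star n i :: u) w')
  \/ (~ is_source w i /\ commutation_equiv w w').

Definition reflection_step (n : nat) (w w' : seq nat) : Prop :=
  exists2 i : nat, (0 < i <= n.*2.+1)%N &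
    right_reflection n i w w' \/ left_reflection n i w w'.

Definition base_word (n : nat) : seq nat :=
  flatten [seq [seq iter k (star n) j | j <- iota 1 n.+1]
          | k <- iota 0 n.*2.+1].

(* The class [w] is twisted adapted. *)
Definition twisted_adapted (n : nat) (w : seq nat) : Prop :=
  exists2 u : seq nat,
    clos_refl_trans (seq nat) (reflection_step n) (base_word n) u &
    commutation_equiv u w.

(* ** The quiver Upsilon *)

Definition letter (w : seq nat) (k : nat) : nat := nth 0%N w k.

(* beta_(k+1) for the 0-based position k *)
Definition root_at (m : nat) (w : seq nat) (k : nat) : 'rV[int]_m.+1 :=
  word_act (take k w) (simple_root m (letter w k)).

(* Arrow from the root at position k to the root at position j: no letter
   strictly between the two positions equals either of the end letters. *)
Definition arrow (w : seq nat) (k j : nat) : bool :=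
  [&& (j < k)%N, (k < size w)%N, adjacent (letter w k) (letter w j) &
    all (fun l => (letter w l != letter w j) && (letter w l != letter w k))
        (iota j.+1 (k - j.+1))].

(* ** Dynkin quivers of type A_m; Q i j means that there is an arrow i -> j *)

Definition dynkin_quiver (m : nat) (Q : rel nat) : Prop :=
  forall i j : nat,
    if [&& (0 < i <= m)%N, (0 < j <= m)%N & adjacent i j]
    then Q i j = ~~ Q j i
    else Q i j = false.

Definition reverse_at (Q : rel nat) (v : nat) : rel nat :=
  fun i j => if (i == v) || (j == v) then Q j i else Q i j.

Definition quiver_sink (Q : rel nat) (v : nat) : Prop :=
  forall j : nat, ~~ Q v j.

Fixpoint adapted (Q : rel nat) (w : seq nat) : Prop :=
  if w is j :: w' then quiver_sink Q j /\ adapted (reverse_at Q j) w'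
  else True.

Definition height_function (Q : rel nat) (xi : nat -> int) : Prop :=
  forall i j : nat, Q i j -> xi j = xi i + 1.

(* ** Coordinates *)

Definition shift (n j : nat) : nat := if (j <= n)%N then j else j.-1.

Definition Pword (n : nat) (w : seq nat) : seq nat :=
  [seq shift n j | j <- w & j != n.+1].

(* Second coordinate at a position whose letter is not n+1. *)
Definition outer_height (n : nat) (w : seq nat) (xi : nat -> int) (k : nat) :
    rat :=
  (xi (shift n (letter w k)))%:~R
    - 2 * (count_mem (letter w k) (take k w))%:R.

(* The root at position k has coordinate c. The neighbours in the quiver of a
   root of residue n+1 have residue n or n+2. *)
Definition has_coord_at (n : nat) (w : seq nat) (xi : nat -> int) (k : nat)
    (c : nat * rat) : bool :=
  (c.1 == letter w k) &&
  if letter w k == n.+1 then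
    has (fun l => (arrow w l k && (c.2 == outer_height n w xi l + 1 / 2))
               || (arrow w k l && (c.2 == outer_height n w xi l - 1 / 2)))
        (iota 0 (size w))
  else c.2 == outer_height n w xi k.

(* Omega n w xi b c means Omega_[w](b) = c; being a relation, it does not
   presuppose that the two rules for residue n+1 are consistent. *)
Definition Omega (n : nat) (w : seq nat) (xi : nat -> int)
    (b : 'rV[int]_(n.*2.+1).+1) (c : nat * rat) : bool :=
  has (fun k => (root_at n.*2.+1 w k == b) && has_coord_at n w xi k c)
      (iota 0 (size w)).
Arguments Omega n w xi b c : clear implicits.

Definition side_residues (n i : nat) : seq nat :=
  if i == n.+2 then [:: n; n + 3]%N
  else if i == n then [:: n - 1; n + 2]%N
  else [:: i - 1; i + 1]%N.

(* Main.v *)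
Require Import Defs.
From mathcomp Require Import all_boot all_order all_algebra.
From mathcomp Require Import zify ring lra.
Import Order.TTheory GRing.Theory Num.Theory.
Local Open Scope ring_scope.

Set Implicit Arguments.
Unset Strict Implicit.
Unset Printing Implicit Defensive.

(** The identity is a mesh relation in disguise.  Read a word [w] of [w_0] from
    left to right and follow the image of the simple root [alpha_i] under the
    prefix read so far.  From one occurrence of [i] to the next, this image
    goes from minus the first root of residue [i] to the second one, and every
    letter adjacent to [i] that is passed adds its own root.  Hence the sum of
    two consecutive roots of residue [i] is the sum of the roots of the
    neighbouring letters in between ([root_mesh]).  What remains is to match
    these letters with the coordinates.

    Away from the residue [n+1], the heights are dictated by [Q]: a letter of an
    adapted word is a sink when it is read, so it is then one higher than its
    neighbours, while reading it lowers it by 2 ([adapted_height]).  Thus the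
    height of an occurrence of [j] is determined by the number of occurrences
    of a neighbour [i] before it ([outer_height_adapted]), and height [p - 1]
    means lying between the roots of heights [p] and [p - 2] of residue [i].

    For the residue [n+1] one needs to know that in [w] the letters [n+1]
    alternate with the letters in [{n, n+2}].  This is where twisted
    adaptedness enters.  Record the subword of the letters [n, n+1, n+2] as a
    sequence of booleans telling whether a letter is [n+1].  A commutation does
    not change this sequence, and a reflection functor moves a letter from one
    end to the other and replaces [i] by [i^*], so it only rotates the
    sequence.  The sequence of the base word alternates cyclically, hence so
    does that of [w] ([middle_twisted_adapted]).  Together with adaptedness,
    the middle letters read [n+1, n, n+1, n+2, n+1, n, ...], and the heights of
    [n] and [n+2] go down by 1 each time ([middle_height]).

    If [i] is neither [n] nor [n+2], the letters between two consecutive [i]'s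
    that are adjacent to [i] are exactly the prescribed ones.  If [i = n], say,
    the mesh relation produces the roots of two letters [n+1] instead of a root
    of residue [n+2]; but these letters enclose a single [n+2] and no [n], so
    the mesh relation for [n+1] turns their sum into the root of residue [n+2]
    ([middle_merge]). *)

(** * The simple reflections *)

Lemma dotvDl m (u v x : 'rV[int]_m.+1) : dotv (u + v) x = dotv u x + dotv v x.
Proof.
by rewrite /dotv -big_split; apply: eq_bigr => j _; rewrite mxE mulrDl.
Qed.

Lemma dotvZl m a (u x : 'rV[int]_m.+1) : dotv (a *: u) x = a * dotv u x.
Proof.
by rewrite /dotv mulr_sumr; apply: eq_bigr => j _; rewrite mxE mulrA.
Qed.

Lemma dotvC m (u v : 'rV[int]_m.+1) : dotv u v = dotv v u.
Proof. by apply: eq_bigr => j _; rewrite mulrC. Qed.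

Lemma dotvBl m (u v x : 'rV[int]_m.+1) : dotv (u - v) x = dotv u x - dotv v x.
Proof. by rewrite -scaleN1r dotvDl dotvZl mulN1r. Qed.

Lemma dotvBr m (x u v : 'rV[int]_m.+1) : dotv x (u - v) = dotv x u - dotv x v.
Proof. by rewrite dotvC dotvBl !(dotvC x). Qed.

Lemma dotv_eps m a b : (0 < a <= m.+1)%N ->
  dotv (eps m a) (eps m b) = (a == b)%:R.
Proof.
move=> ha; have lta : (a.-1 < m.+1)%N by lia.
rewrite /dotv (bigD1 (Ordinal lta)) //= big1 => [|j jna].
  by rewrite !mxE /= addr0 prednK ?eqxx ?mul1r //; lia.
rewrite !mxE; case: eqP => [eja|_]; last by rewrite mul0r.
by case/eqP: jna; apply: val_inj => /=; lia.
Qed.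

Lemma dotv_root m i : (0 < i <= m)%N ->
  dotv (simple_root m i) (simple_root m i) = 2.
Proof.
move=> hi; rewrite /simple_root dotvBl !dotvBr !dotv_eps; [|lia..].
by rewrite !eqxx (gtn_eqF (ltnSn i)) (ltn_eqF (ltnSn i)).
Qed.

Lemma reflD m i (u v : 'rV[int]_m.+1) :
  simple_refl i (u + v) = simple_refl i u + simple_refl i v.
Proof. by rewrite /simple_refl dotvDl scalerDl opprD addrACA. Qed.

Lemma reflZ m i a (u : 'rV[int]_m.+1) :
  simple_refl i (a *: u) = a *: simple_refl i u.
Proof.
rewrite /simple_refl dotvZl; move: (simple_root m i) => r.
by rewrite scalerBr scalerA.
Qed.

Lemma reflK m i : (0 < i <= m)%N -> involutive (@simple_refl m i).
Proof.
move=> hi u; rewrite /simple_refl dotvBl dotvZl dotv_root //.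
rewrite -addrA -opprD -scalerDl.
set a := dotv _ _; have -> : a + (a - a * 2) = 0 by ring.
by rewrite scale0r subr0.
Qed.

Lemma refl_isometry m i (u v : 'rV[int]_m.+1) : (0 < i <= m)%N ->
  dotv (simple_refl i u) (simple_refl i v) = dotv u v.
Proof.
move=> /dotv_root; rewrite /simple_refl; move: (simple_root m i) => r rr.
rewrite dotvBl !dotvBr !dotvZl !(dotvC _ (_ *: _)) !dotvZl rr !(dotvC r).
by ring.
Qed.

Definition swap_index (i k : nat) : nat :=
  if k == i then i.+1 else if k == i.+1 then i else k.

Lemma refl_eps m i k : (0 < k <= m.+1)%N ->
  simple_refl i (eps m k) = eps m (swap_index i k).
Proof.
move=> hk; rewrite /simple_refl /simple_root dotvBr !dotv_eps // /swap_index.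
case: (eqVneq k i) => [->|_].
  by rewrite (ltn_eqF (ltnSn i)) subr0 scale1r opprB addrC subrK.
case: (eqVneq k i.+1) => [->|_].
  by rewrite sub0r scaleN1r opprK addrC subrK.
by rewrite subr0 scale0r subr0.
Qed.

Lemma refl_simple_root m i : (0 < i <= m)%N ->
  simple_refl i (simple_root m i) = - simple_root m i.
Proof.
move=> hi; rewrite /simple_refl dotv_root // scaler_nat mulr2n opprD addrA.
by rewrite subrr sub0r.
Qed.

Lemma refl_neighbour m c i : (0 < c <= m)%N -> (0 < i <= m)%N -> c != i ->
  simple_refl c (simple_root m i) =
    simple_root m i + (if adjacent c i then simple_root m c else 0).
Proof.
move=> hc hi cni; rewrite {1 2}/simple_root reflD -scaleN1r reflZ scaleN1r.
rewrite !refl_eps; [|lia..].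
rewrite /swap_index /adjacent eqSS [i == c]eq_sym (negbTE cni) (eq_sym c.+1).
case: (eqVneq i c.+1) => [->|]; last case: (eqVneq c i.+1) => [->|] //=.
- have -> : (c.+2 == c) = false by lia.
  by rewrite /simple_root scaleN1r [RHS]addrC addrA subrK.
- by rewrite scaleN1r /simple_root addrA subrK.
- by move=> cni1 inc1; rewrite scaleN1r addr0.
Qed.

(** * Words acting on the root lattice *)

Lemma word_actD m v (x y : 'rV[int]_m.+1) :
  word_act v (x + y) = word_act v x + word_act v y.
Proof. by elim: v => //= c v ->; rewrite reflD. Qed.

Lemma word_act0 m v : word_act v 0 = 0 :> 'rV[int]_m.+1.
Proof.
by apply: (addrI (word_act v 0)); rewrite -word_actD !addr0.
Qed.

Lemma word_actZ m v a (x : 'rV[int]_m.+1) :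
  word_act v (a *: x) = a *: word_act v x.
Proof. by elim: v => //= c v ->; rewrite reflZ. Qed.

Lemma word_actN m v (x : 'rV[int]_m.+1) : word_act v (- x) = - word_act v x.
Proof. by rewrite -scaleN1r word_actZ scaleN1r. Qed.

Lemma word_act_cat m u v (x : 'rV[int]_m.+1) :
  word_act (u ++ v) x = word_act u (word_act v x).
Proof. exact: foldr_cat. Qed.

Lemma word_act_rcons m u c (x : 'rV[int]_m.+1) :
  word_act (rcons u c) x = word_act u (simple_refl c x).
Proof. exact: foldr_rcons. Qed.

Lemma word_act_isometry m v (x y : 'rV[int]_m.+1) : word_over m v ->
  dotv (word_act v x) (word_act v y) = dotv x y.
Proof.
elim: v => //= c v IH /andP[hc hv]; rewrite refl_isometry //; exact: IH.
Qed.

Lemma word_act_inj m v : word_over m v -> injective (@word_act m v).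
Proof.
elim: v => [_ x y //|c v IH /andP[hc hv]] x y /=.
by move/(can_inj (reflK hc)); apply: IH.
Qed.

Lemma word_over_letter m w k : word_over m w -> (k < size w)%N ->
  (0 < letter w k <= m)%N.
Proof. by move=> /allP hw hk; apply: hw; apply: mem_nth. Qed.

Lemma word_over_take m w k : word_over m w -> word_over m (take k w).
Proof. by rewrite -{1}(cat_take_drop k w) /word_over all_cat => /andP[]. Qed.

(** The image of the simple root of [i] under the prefixes of the word starts
    at minus the first root, just after its letter, and ends at the second one;
    on the way, a neighbour [c] of [i] contributes its own root because [s_c]
    maps [alpha_i] to [alpha_i + alpha_c], and the other letters fix
    [alpha_i]. *)
Lemma root_mesh m w k k' : word_over m w -> (k < k' < size w)%N ->
  letter w k' = letter w k ->
  (forall l, (k < l < k')%N -> letter w l != letter w k) ->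
  root_at m w k + root_at m w k' =
    \sum_(k.+1 <= l < k' | adjacent (letter w l) (letter w k)) root_at m w l.
Proof.
move=> hw /andP[kk' hk'] ek' hno; set i := letter w k in ek' hno *.
have hi : (0 < i <= m)%N by apply: word_over_letter => //; lia.
have acts t : (k < t <= k')%N -> word_act (take t w) (simple_root m i) =
    - root_at m w k +
    \sum_(k.+1 <= l < t | adjacent (letter w l) i) root_at m w l.
  elim: t => // t IH; rewrite ltnS => /andP[kt tk'].
  rewrite (take_nth 0%N); last lia.
  rewrite word_act_rcons -/(letter w t).
  move: kt; rewrite leq_eqVlt => /predU1P[<-|kt].
    by rewrite -/i refl_simple_root // word_actN big_geq // addr0.
  have ct : (0 < letter w t <= m)%N by apply: word_over_letter => //; lia.
  rewrite big_mkcond big_nat_recr //= -big_mkcond addrA -IH; last lia.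
  rewrite refl_neighbour //; last by apply: hno; lia.
  rewrite word_actD; congr (_ + _); case: ifP => // _.
  by rewrite word_act0.
by rewrite {2}/root_at ek' acts ?kk' ?leqnn // addrA subrr add0r.
Qed.

(** * The roots of a reduced word *)

Lemma reduced_cat m u v : reduced m (u ++ v) -> reduced m u /\ reduced m v.
Proof.
rewrite /reduced /word_over all_cat => -[/andP[hu hv] hmin]; split; split=> //.
- move=> u' hu' eu; have := hmin (u' ++ v).
  rewrite all_cat hu' hv !size_cat leq_add2r; apply=> // x.
  by rewrite !word_act_cat eu.
- move=> v' hv' ev; have := hmin (u ++ v').
  rewrite all_cat hu hv' !size_cat leq_add2l; apply=> // x.
  by rewrite !word_act_cat ev.
Qed.

Definition is_pos_root m (v : 'rV[int]_m.+1) : Prop :=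
  exists a b, (0 < a < b)%N /\ (b <= m.+1)%N /\ v = eps m a - eps m b.

Lemma is_pos_rootP m v : reflect (is_pos_root v) (v \in pos_roots m).
Proof.
apply: (iffP allpairsPdep) => [[a [b []]]|[a [b [hab [hb ->]]]]].
  rewrite !mem_iota => ha hb ->; exists a, b; split; first by lia.
  by split=> //; lia.
by exists a, b; rewrite !mem_iota; split=> //; lia.
Qed.

(** This is the exchange condition: the only positive root that [s_j] makes
    negative is [alpha_j], and if [alpha_j] is the image of [alpha_c] under
    [v], then [s_j] is conjugate to [s_c] by [v], so that the word [j v c] acts
    like the shorter word [v]. *)
Lemma reduced_last_root m v c : reduced m (rcons v c) ->
  is_pos_root (word_act v (simple_root m c)).
Proof.
elim: v => [|j v IH] /=; rewrite /= => red.
  have /= := red.1; rewrite andbT => hc.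
  by exists c, c.+1; split; [lia|split; first lia].
have redv : reduced m (rcons v c).
  by have [] := @reduced_cat m [:: j] (rcons v c).
have [a [b [hab [hb vab]]]] := IH redv.
have /= := red.1; rewrite /word_over /= all_rcons => /and3P[hj hc hv].
have /orP[/andP[/eqP ea /eqP eb]|nab] :=
    orbN ((a == j) && (b == j.+1)); last first.
  exists (swap_index j a), (swap_index j b); split; last split.
  - rewrite /swap_index; move: nab hab.
    do 4?case: eqP => /=; lia.
  - by rewrite /swap_index; do 2?case: eqP => /=; lia.
  by rewrite vab -scaleN1r reflD reflZ scaleN1r !refl_eps //; lia.
have := red.2 v hv; rewrite /= size_rcons => short.
suff /short : word_act v =1 @word_act m (j :: rcons v c) by lia.
have ej : simple_root m j = word_act v (simple_root m c).
  by rewrite vab ea eb.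
move=> x; rewrite /= word_act_rcons.
have -> : word_act v (simple_refl c x) = simple_refl j (word_act v x).
  rewrite /simple_refl ej word_act_isometry // word_actD word_actN.
  by rewrite word_actZ.
by rewrite reflK.
Qed.

Lemma root_at_pos m w k : reduced m w -> (k < size w)%N ->
  is_pos_root (root_at m w k).
Proof.
move=> red hk; apply: reduced_last_root; rewrite -take_nth //.
by move: red; rewrite -{1}(cat_take_drop k.+1 w) => /reduced_cat[].
Qed.

Lemma eps_diff_inj m a b c d : a != b ->
  (0 < c <= m.+1)%N -> (0 < d <= m.+1)%N -> c != d ->
  eps m a - eps m b = eps m c - eps m d -> a = c /\ b = d.
Proof.
move=> nab hc hd ncd /rowP e.
have cc : (c.-1 < m.+1)%N by lia.
have dd : (d.-1 < m.+1)%N by lia.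
have := e (Ordinal cc); have := e (Ordinal dd); rewrite !mxE /=.
rewrite !prednK; [|lia..].
rewrite !eqxx (negbTE ncd) [d == c]eq_sym (negbTE ncd).
rewrite [d == a]eq_sym [d == b]eq_sym.
rewrite [c == a]eq_sym [c == b]eq_sym.
by do 4?case: eqP => /=.
Qed.

Lemma uniq_pos_roots m : uniq (pos_roots m).
Proof.
apply: allpairs_uniq_dep; [exact: iota_uniq|by move=> a _; apply: iota_uniq|].
move=> _ _ /allpairsPdep[a [b [+ + ->]]] /allpairsPdep[c [d [+ + ->]]] /=.
rewrite !mem_iota => ha hb hc hd e.
by case: (eps_diff_inj _ _ _ _ e) => [||||-> ->]//; lia.
Qed.

(** If two positions [k < l] had the same root, the letters strictly between
    them would send the simple root of the letter at [l] to minus the simple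
    root of the letter at [k], against [reduced_last_root]. *)
Lemma root_at_neq m w k l : reduced m w -> (k < l < size w)%N ->
  root_at m w k != root_at m w l.
Proof.
move=> red /andP[kl hl]; apply/eqP; rewrite /root_at => e.
have hw := red.1; have hk := word_over_letter hw (ltn_trans kl hl).
pose v := drop k.+1 (take l w).
have etake : take l w = rcons (take k w) (letter w k) ++ v.
  rewrite -take_nth ?(ltn_trans kl hl) // -(cat_take_drop k.+1 (take l w)).
  by rewrite take_takel //; congr (_ ++ _).
have redv : reduced m (rcons v (letter w l)).
  have : reduced m (take l.+1 w).
    by move: red; rewrite -{1}(cat_take_drop l.+1 w) => /reduced_cat[].
  by rewrite (take_nth 0%N) // etake rcons_cat => /reduced_cat[].
have [a [b [hab [hb vab]]]] := reduced_last_root redv.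
move: e; rewrite etake word_act_cat word_act_rcons.
move=> /(word_act_inj (word_over_take _ hw)).
move=> /(congr1 (@simple_refl m (letter w k))).
rewrite reflK // refl_simple_root // vab /simple_root opprB => /esym e.
by case: (eps_diff_inj _ _ _ _ e); lia.
Qed.

(** Distinct positions carry distinct roots, so a sum over roots selected by a
    condition on their positions is a sum over positions. *)
Lemma sum_pos_roots m w (P : pred 'rV[int]_m.+1) (S : pred nat) :
  reduced m w ->
  (forall v, P v <-> exists k, [/\ (k < size w)%N, S k & root_at m w k = v]) ->
  \sum_(v <- pos_roots m | P v) v =
    \sum_(0 <= k < size w | S k) root_at m w k.
Proof.
move=> red PS; rewrite -big_filter -[RHS]big_filter.
rewrite -(big_map (root_at m w) xpredT id); apply: perm_big.
apply: uniq_perm.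
- exact/filter_uniq/uniq_pos_roots.
- rewrite map_inj_in_uniq ?filter_uniq ?iota_uniq // => k l.
  rewrite !mem_filter !mem_index_iota => /andP[_ hk] /andP[_ hl] e.
  case: (ltngtP k l) => // kl.
    by have := @root_at_neq m w k l red; rewrite kl hl e eqxx => /(_ isT).
  by have := @root_at_neq m w l k red; rewrite kl hk e eqxx => /(_ isT).
move=> v; apply/idP/mapP.
  rewrite mem_filter => /andP[/PS[k [hk Sk <-]] _]; exists k => //.
  by rewrite mem_filter Sk mem_index_iota.
case=> k; rewrite mem_filter mem_index_iota => /andP[Sk hk] ->.
rewrite mem_filter; apply/andP; split; first by apply/PS; exists k.
by apply/is_pos_rootP/root_at_pos.
Qed.

(** * Counting occurrences of a letter *)

Definition occ (c : nat) (w : seq nat) (k : nat) : nat :=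
  count_mem c (take k w).

Lemma occ_le c w k l : (k <= l)%N -> (occ c w k <= occ c w l)%N.
Proof.
move=> kl; rewrite /occ -(cat_take_drop k (take l w)) take_takel //.
by rewrite count_cat leq_addr.
Qed.

Lemma occ_succ c w k : (k < size w)%N ->
  occ c w k.+1 = (occ c w k + (letter w k == c))%N.
Proof.
by move=> hk; rewrite /occ (take_nth 0%N) // -cats1 count_cat /= addn0.
Qed.

Lemma occ_between c w k k' l : (k < size w)%N -> (k' < size w)%N ->
  letter w k = c -> letter w k' = c ->
  occ c w k' = (occ c w k).+1 ->
  (occ c w l == (occ c w k).+1) = (k < l <= k')%N.
Proof.
move=> hk hk' ek ek' e.
have := occ_succ c hk; have := occ_succ c hk'.
rewrite ek ek' eqxx => s' s.
have [lk|kl] := leqP l k; first by have := occ_le c w lk; lia.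
have [lk'|k'l] := leqP l k'; last by have := occ_le c w k'l; lia.
by have := occ_le c w kl; have := occ_le c w lk'; lia.
Qed.

Lemma no_occurrence c w a b l : (b <= size w)%N -> (a <= l < b)%N ->
  occ c w b = occ c w a -> letter w l != c.
Proof.
move=> hb /andP[al lb] e; apply/eqP => el.
have := @occ_succ c w l; rewrite el eqxx => /(_ (leq_trans lb hb)).
by have := occ_le c w al; have := occ_le c w lb; lia.
Qed.

Lemma one_occurrence (V : nmodType) (F : nat -> V) c w a b :
  (a <= b <= size w)%N ->
  occ c w b = (occ c w a).+1 ->
  exists l, [/\ (a <= l < b)%N, letter w l = c &
    \sum_(a <= k < b | letter w k == c) F k = F l].
Proof.
elim: b => [|b IH] /andP[ab hb] e.
  by move: ab e; case: a {hb} => //= _; lia.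
move: ab; rewrite leq_eqVlt => /predU1P[eab|]; first by rewrite eab in e; lia.
rewrite ltnS => ab; move: e; rewrite occ_succ //.
rewrite big_mkcond big_nat_recr //= -big_mkcond.
case: eqP => [el|_] e; last first.
  have hb' : (a <= b <= size w)%N by lia.
  have [|l [hl el ->]] := IH hb'; first by rewrite addn0 in e.
  by exists l; rewrite addr0; split=> //; lia.
exists b; split=> //; first by lia.
rewrite big_nat_cond big_pred0 ?add0r // => l; apply/negbTE/negP => /andP[hl].
by apply/negP/(no_occurrence (ltnW hb) hl); lia.
Qed.

(** * Heights along an adapted word *)

Lemma dynkin_reverse m Q x :
  dynkin_quiver m Q -> dynkin_quiver m (reverse_at Q x).
Proof.
move=> dQ i j; have := dQ i j; have := dQ j i; rewrite /reverse_at.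
have -> : adjacent j i = adjacent i j by rewrite /adjacent orbC.
rewrite [(j == x) || _]orbC andbCA.
by case: ifP => _; case: ifP => _ // -> -> //; rewrite ?negbK.
Qed.

(** Reversing the arrows at a sink amounts to lowering its height by 2.  So the
    current quiver has the height function sending [y] to [xi y] minus twice
    the number of [y]'s already read, and the next letter, being a sink, is one
    higher than its neighbours. *)
Lemma adapted_height m Q xi u x v y :
  dynkin_quiver m Q -> height_function Q xi -> adapted Q (u ++ x :: v) ->
  word_over m (u ++ x :: v) -> (0 < y <= m)%N -> adjacent x y ->
  xi x - 2 * (count_mem x u)%:Z = xi y - 2 * (count_mem y u)%:Z + 1.
Proof.
elim: u Q xi => [|z u IH] Q xi dQ hxi /= [sink ad] /andP[hz hu] hy xy.
  rewrite !mulr0 !subr0; apply: hxi; have := dQ y x; rewrite hy hz.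
  have -> : adjacent y x = adjacent x y by rewrite /adjacent orbC.
  by rewrite xy /= => ->; apply: sink.
pose xi' k := xi k - 2 * (k == z)%:Z.
have hxi' : height_function (reverse_at Q z) xi'.
  move=> i j; rewrite /reverse_at /xi'.
  case: (eqVneq i z) => [->|niz] /=.
    move=> Qjz; have := hxi _ _ Qjz.
    case: (eqVneq j z) Qjz => [->|_ _]; first by rewrite (negbTE (sink z)).
    lia.
  case: (eqVneq j z) => [->|njz] /=; first by rewrite (negbTE (sink i)).
  by rewrite !mulr0 !subr0; apply: hxi.
have := IH _ _ (dynkin_reverse z dQ) hxi' ad hu hy xy; rewrite /xi'.
by rewrite ![_ == z]eq_sym !PoszD !mulrDr !opprD !addrA.
Qed.

Lemma Pword_cat n u v : Pword n (u ++ v) = Pword n u ++ Pword n v.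
Proof. by rewrite /Pword filter_cat map_cat. Qed.

Lemma Pword_over n w : (0 < n)%N -> word_over n.*2.+1 w ->
  word_over n.*2 (Pword n w).
Proof.
move=> hn /allP hw; apply/allP => _ /mapP[j + ->].
by rewrite mem_filter => /andP[jc /hw]; rewrite /shift; case: ifP; lia.
Qed.

Lemma count_Pword n j u : j != n.+1 -> 
  count_mem (shift n j) (Pword n u) = count_mem j u.
Proof.
move=> jc; elim: u => //= x u IH; rewrite /Pword /=.
case: eqP => [->|xc] /=; first by rewrite -/(Pword n u) IH eq_sym (negbTE jc).
rewrite -/(Pword n u) IH; congr (nat_of_bool _ + _)%N.
by rewrite /shift; do 2?case: ifP; lia.
Qed.

Lemma outer_height_adapted n w Q xi l i :
  (0 < n)%N -> word_over n.*2.+1 w ->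
  dynkin_quiver n.*2 Q -> adapted Q (Pword n w) -> height_function Q xi ->
  (l < size w)%N -> letter w l != n.+1 -> (0 < i <= n.*2.+1)%N -> i != n.+1 ->
  adjacent (shift n (letter w l)) (shift n i) ->
  outer_height n w xi l =
    (xi (shift n i))%:~R - 2 * (occ i w l)%:R + 1.
Proof.
move=> hn hw dQ ad hxi hl lc hi ic adj; have hP := Pword_over hn hw.
have ew : Pword n w = Pword n (take l w) ++
    shift n (letter w l) :: Pword n (drop l.+1 w).
  rewrite -{1}(cat_take_drop l w) (drop_nth 0%N) // Pword_cat; congr (_ ++ _).
  by rewrite /Pword /= lc.
rewrite ew in ad hP.
have hs : (0 < shift n i <= n.*2)%N by rewrite /shift; case: ifP; lia.
have := adapted_height dQ hxi ad hP hs adj; rewrite !count_Pword //.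
move=> /(congr1 (fun z : int => z%:~R : rat)).
by rewrite !(rmorphD, rmorphN, rmorphM) /= /outer_height -!pmulrn.
Qed.

(** * The three middle letters *)

(** The subword of the letters [n], [n+1], [n+2], recording only whether a
    letter is [n+1]: forgetting the difference between [n] and [n+2] makes it
    invariant under commutations and under the involution [star]. *)
Definition middle n (w : seq nat) : seq bool :=
  [seq x == n.+1 | x <- w & (n <= x <= n.+2)%N].

Lemma middle_cat n u v : middle n (u ++ v) = middle n u ++ middle n v.
Proof. by rewrite /middle filter_cat map_cat. Qed.

Lemma middle_commutation n w w' :
  commutation_equiv w w' -> middle n w = middle n w'.
Proof.
elim=> {w w'} [_ _ [u v i j ij]||w1 w2 w3 _ -> _ -> //] //.
rewrite !middle_cat; congr (_ ++ _); rewrite /middle /=; move: ij; rewrite /far.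
by do 2?case: ifP => //=; move=> hj hi ij; congr [:: _, _ & _]; lia.
Qed.

Lemma middle_star n i : (i <= n.*2.+2)%N ->
  middle n [:: star n i] = middle n [:: i].
Proof.
move=> hi; rewrite /middle /star /=.
do 2?case: ifP => //=; do 1?(move=> ? ?; congr [:: _]); lia.
Qed.

Local Notation neq_bool := (fun x y : bool => x != y).

(** Up to [star], which [middle] does not see, a reflection functor moves a
    letter from one end of the word to the other. *)
Lemma middle_reflection n w w' : reflection_step n w w' ->
  cycle neq_bool (middle n w) ->
  cycle neq_bool (middle n w').
Proof.
have rotate (a b : seq bool) : cycle neq_bool (a ++ b) =
    cycle neq_bool (b ++ a).
  by rewrite -(rot_cycle (size a)) rot_size_cat.
case=> i hi [] [[u [wu uw']]|[_ /middle_commutation ->]] //;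
  rewrite (middle_commutation n wu) -(middle_commutation n uw').
- by rewrite -cats1 -cat1s !middle_cat middle_star 1?rotate //; lia.
- rewrite -cats1 -[star n i :: u]cat1s !middle_cat middle_star 1?rotate //.
  by lia.
Qed.

Lemma middle_base n : (0 < n)%N ->
  middle n (base_word n) = flatten (nseq n.*2.+1 [:: false; true]).
Proof.
move=> hn; rewrite /base_word.
have block k : middle n [seq iter k (star n) j | j <- iota 1 n.+1] =
    [:: false; true].
  have small : all (fun x => x <= n.*2.+2)%N (iota 1 n.+1).
    by apply/allP => x; rewrite mem_iota; lia.
  have -> : middle n [seq iter k (star n) j | j <- iota 1 n.+1] =
      middle n (iota 1 n.+1).
    elim: (iota 1 n.+1) small => //= x s IH /andP[hx hs].
    rewrite -cat1s middle_cat -[x :: s]cat1s middle_cat IH //; congr (_ ++ _).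
    elim: k {IH} => //= k <-; apply: middle_star.
    by case: k => //= k; rewrite /star; lia.
  have -> : (n.+1 = n.-1 + 2)%N by lia.
  rewrite iotaD middle_cat /middle /= (_ : [seq _ <- _ | _] = [::]) /=.
    have [-> ->] : (n <= 1 + n.-1 <= n.+2)%N /\ (n <= (1 + n.-1).+1 <= n.+2)%N.
      by lia.
    by rewrite /=; congr [:: _; _]; lia.
  by apply/eqP; rewrite -[_ == _]negbK -has_filter; apply/hasPn => x;
     rewrite mem_iota; lia.
have blocks (F : nat -> seq nat) N k :
    (forall k, middle n (F k) = [:: false; true]) ->
    middle n (flatten [seq F k | k <- iota k N]) =
    flatten (nseq N [:: false; true]).
  by move=> mF; elim: N k => //= N IH k; rewrite middle_cat mF IH.
exact: blocks.
Qed.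

(** The property has to be cyclic in order to survive the reflection functors,
    and it can be so because the sequence of the base word has even length. *)
Lemma middle_twisted_adapted n w : (0 < n)%N -> twisted_adapted n w ->
  cycle neq_bool (middle n w).
Proof.
move=> hn [u refl /middle_commutation <-].
have : cycle neq_bool (middle n (base_word n)).
  rewrite middle_base // (cycle_path true).
  have -> : last true (flatten (nseq n.*2.+1 [:: false; true])) = true.
    by elim: (n.*2.+1) => //= N ->.
  by elim: (n.*2.+1).
elim: refl => {u} [w1 w2 /middle_reflection||w1 w2 w3 _ IH1 _ IH2 /IH1/IH2] //.
Qed.

(** In an alternating sequence the two values occur equally often before a
    given entry, up to a correction by the first and the given entry; [x] is
    the opposite of the first entry. *)
Lemma alternating_count x (b1 b2 : seq bool) y :
  path neq_bool x (b1 ++ y :: b2) ->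
  (count id b1 + x = count negb b1 + ~~ y)%N.
Proof.
elim: b1 x => [|z b1 IH] x /= /andP[+ hp].
  by case: x y {hp} => [] [].
by have := IH _ hp; case: x z {IH hp} => [] [] //=; lia.
Qed.

Lemma count_middle_true n u : count id (middle n u) = count_mem n.+1 u.
Proof.
elim: u => //= x u IH; rewrite -cat1s middle_cat count_cat IH; congr (_ + _)%N.
by rewrite /middle /=; case: ifP => /=; lia.
Qed.

Lemma count_middle_false n u :
  count negb (middle n u) = (count_mem n u + count_mem n.+2 u)%N.
Proof.
elim: u => //= x u IH; rewrite -cat1s middle_cat count_cat IH addnACA.
by congr (_ + _)%N; rewrite /middle /=; case: ifP => /=; lia.
Qed.

(** The constant [d] is 0 or 1 according to whether [n+1] comes first among the
    three letters or not. *)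
Lemma middle_counts n w : (0 < n)%N -> twisted_adapted n w ->
  exists d : bool, forall l, (l < size w)%N -> (n <= letter w l <= n.+2)%N ->
    (occ n.+1 w l + d =
     occ n w l + occ n.+2 w l
       + (letter w l != n.+1))%N.
Proof.
move=> hn /(middle_twisted_adapted hn); rewrite (cycle_path true).
move: (last _ _) => d alt; exists d => l hl ml.
rewrite /occ -count_middle_true -count_middle_false.
apply: (@alternating_count _ _ (middle n (drop l.+1 w))).
suff <- : middle n w = middle n (take l w) ++ (letter w l == n.+1)
    :: middle n (drop l.+1 w) by [].
rewrite -{1}(cat_take_drop l w) (drop_nth 0%N) // middle_cat; congr (_ ++ _).
by rewrite /middle /= ml.
Qed.

(** * Coordinates and positions *)

Lemma outerP n w xi v j q : j != n.+1 -> Omega n w xi v (j, q) ->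
  exists k, [/\ (k < size w)%N, letter w k = j, outer_height n w xi k = q &
    root_at n.*2.+1 w k = v].
Proof.
move=> jc /hasP[k]; rewrite mem_iota => hk /andP[/eqP rk /andP[/eqP /= ej]].
by rewrite -ej (negbTE jc) => /eqP ->; exists k; split.
Qed.

Lemma Omega_outer n w xi k : (k < size w)%N -> letter w k != n.+1 ->
  Omega n w xi (root_at n.*2.+1 w k) (letter w k, outer_height n w xi k).
Proof.
move=> hk kc; apply/hasP; exists k; first by rewrite mem_iota.
by rewrite /has_coord_at (negbTE kc) /= !eqxx.
Qed.

(** Averaging the definition of the height of an [n] with its expression in
    [outer_height_adapted] by the number of [n+2]'s before it, and likewise with
    [n] and [n+2] exchanged, shows that the height depends only on the total
    number of these two letters before.  By alternation, this is the number of
    [n+1]'s before, up to a constant. *)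
Lemma middle_height n w Q xi : (0 < n)%N -> word_over n.*2.+1 w ->
  twisted_adapted n w -> dynkin_quiver n.*2 Q -> adapted Q (Pword n w) ->
  height_function Q xi ->
  exists h, forall l, (l < size w)%N -> adjacent (letter w l) n.+1 ->
    outer_height n w xi l = h - (occ n.+1 w l)%:R.
Proof.
move=> hn hw tw dQ ad hxi; have [d hd] := middle_counts hn tw.
exists (((xi n)%:~R + (xi n.+1)%:~R + 1) / 2 + 1 - d%:R) => l hl adj.
have lc : letter w l != n.+1 by move: adj; rewrite /adjacent; lia.
have ml : (n <= letter w l <= n.+2)%N by move: adj; rewrite /adjacent; lia.
have := congr1 (fun k => k%:R : rat) (hd l hl ml); rewrite lc !natrD => cnt.
have height i : (i == n) || (i == n.+2) -> i != letter w l ->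
    outer_height n w xi l = (xi (shift n i))%:~R - 2 * (occ i w l)%:R + 1.
  move=> hi il; apply: (outer_height_adapted hn hw dQ ad hxi) => //; [lia|lia|].
  by move: adj; rewrite /adjacent /shift; do 2?case: ifP; lia.
have [el|el] : letter w l = n \/ letter w l = n.+2.
  by move: adj; rewrite /adjacent; lia.
- have := height n.+2; rewrite el eqxx orbT => /(_ isT).
  have -> : (n.+2 != n) = true by lia.
  move=> /(_ isT); move: cnt; rewrite /outer_height el -/(occ n w l).
  rewrite /shift leqnn (_ : (n.+2 <= n)%N = false) /=; last by lia.
  by move=> ? ?; lra.
- have := height n; rewrite el eqxx => /(_ isT).
  have -> : (n != n.+2) = true by lia.
  move=> /(_ isT); move: cnt; rewrite /outer_height el -/(occ n.+2 w l).
  rewrite /shift leqnn (_ : (n.+2 <= n)%N = false) /=; last by lia.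
  by move=> ? ?; lra.
Qed.

(** The two rules for the residue [n+1] agree: between the neighbour [l] before
    and the neighbour [l] after position [k] there is one [n+1], at [k] itself,
    so the height drops by 1, from [q + 1/2] to [q - 1/2]. *)
Lemma middleP n w xi h v q :
  (forall l, (l < size w)%N -> adjacent (letter w l) n.+1 ->
    outer_height n w xi l = h - (occ n.+1 w l)%:R) ->
  Omega n w xi v (n.+1, q) ->
  exists k, [/\ (k < size w)%N, letter w k = n.+1,
    q = h - (occ n.+1 w k)%:R - 1 / 2 & root_at n.*2.+1 w k = v].
Proof.
move=> hh /hasP[k]; rewrite mem_iota => hk /andP[/eqP rk /andP[/eqP /= ek]].
rewrite -ek eqxx => /hasP[l _ hl]; exists k; split=> //.
have between a b : arrow w b a -> (letter w b = n.+1) \/ (letter w a = n.+1) ->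
    occ n.+1 w b = (occ n.+1 w a + (letter w a == n.+1))%N.
  move=> /and4P[ab hb _ /allP no] ec; rewrite -occ_succ; last by lia.
  have constant t : (t <= b)%N -> (a < t)%N -> occ n.+1 w t = occ n.+1 w a.+1.
    elim: t => // t IH tb; rewrite ltnS leq_eqVlt => /predU1P[->//|at_].
    rewrite occ_succ; last by lia.
    rewrite IH //; last by lia.
    have := no t; rewrite mem_iota => /(_ _)/andP[|ta tb']; first by lia.
    by case: ec => <-; rewrite ?(negbTE ta) ?(negbTE tb') addn0.
  exact: constant.
case/orP: hl => /andP[arr /eqP ->].
- have := between _ _ arr (or_intror (esym ek)); rewrite -ek eqxx => e.
  case/and4P: arr => _ hl adj _; rewrite -ek in adj.
  by rewrite (hh l) // e addn1 -natr1; lra.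
- have := between _ _ arr (or_introl (esym ek)).
  case/and4P: arr => lk _ adj _; rewrite -ek in adj.
  have adj' : adjacent (letter w l) n.+1 by move: adj; rewrite /adjacent; lia.
  have -> : (letter w l == n.+1) = false by move: adj; rewrite /adjacent; lia.
  have hl : (l < size w)%N by lia.
  by rewrite addn0 => ->; rewrite (hh l) //; lra.
Qed.

Lemma side_residues_shift n i j : (0 < i)%N -> (0 < j)%N -> i != n.+1 ->
  j \in side_residues n i ->
  j != n.+1 /\ adjacent (shift n j) (shift n i).
Proof.
move=> hi hj ic; rewrite /side_residues /adjacent /shift.
by do 2?case: ifP; rewrite !inE => *; split; do 2?case: ifP; lia.
Qed.

(** Each occurrence of [i] lowers the coordinate by 2, or by 1 if [i = n+1], so
    the coordinates of [beta] and [alpha] are one step apart.  The height of a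
    side letter depends only on the number of [i]'s before it
    ([outer_height_adapted], [middle_height]), and the prescribed value is the
    one taken between the two. *)
Lemma consecutive_positions n w Q xi i p alpha beta : (0 < n)%N ->
  word_over n.*2.+1 w -> twisted_adapted n w -> dynkin_quiver n.*2 Q ->
  adapted Q (Pword n w) -> height_function Q xi ->
  Omega n w xi beta (i, p) ->
  Omega n w xi alpha (i, p - 2 + (i == n.+1)%:R) ->
  exists k k', [/\ (k < k' < size w)%N, letter w k = i, letter w k' = i &
    occ i w k' = (occ i w k).+1] /\
    [/\ root_at n.*2.+1 w k = beta, root_at n.*2.+1 w k' = alpha &
    forall l, (l < size w)%N -> letter w l \in side_residues n i ->
      letter w l != n.+1 /\
      (outer_height n w xi l == p - 1 / (1 + (i == n.+1)%:R)) = (k < l < k')%N].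
Proof.
move=> hn hw tw dQ ad hxi ob oa.
have [h hh] := middle_height hn hw tw dQ ad hxi.
(* It is enough to express the coordinates by numbers of occurrences. *)
suff [k [k' [[hk hk' ek ek'] [e rk rk' sides]]]] : exists k k',
    [/\ (k < size w)%N, (k' < size w)%N, letter w k = i & letter w k' = i] /\
    [/\ occ i w k' = (occ i w k).+1, root_at n.*2.+1 w k = beta,
      root_at n.*2.+1 w k' = alpha &
      forall l, (l < size w)%N -> letter w l \in side_residues n i ->
      [/\ letter w l != n.+1, letter w l != i &
        (outer_height n w xi l == p - 1 / (1 + (i == n.+1)%:R)) =
        (occ i w l == (occ i w k).+1)]].
  exists k, k'; split; split=> //.
    have := occ_between k' hk hk' ek ek' e.
    by rewrite e eqxx leqnn andbT hk' andbT => <-.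
  move=> l hl sl; have [lc li ->] := sides l hl sl; split=> //.
  rewrite (occ_between l hk hk' ek ek' e) [(l <= k')%N]leq_eqVlt.
  by case: eqP => // lk'; move: li; rewrite lk' ek' eqxx.
move: ob oa; have [ic|ic] := eqVneq i n.+1.
  subst i.
  move=> /(middleP hh)[k [hk ek pk rk]] /(middleP hh)[k' [hk' ek' pk' rk']].
  exists k, k'; split; split=> //.
    apply/eqP; rewrite -(eqr_nat rat) -natr1; apply/eqP.
    by rewrite /= in pk'; lra.
  move=> l hl; rewrite /side_residues ltn_eqF // gtn_eqF // !inE => sl.
  have adj : adjacent (letter w l) n.+1 by rewrite /adjacent; lia.
  split; [lia|lia|]; rewrite hh // pk -(eqr_nat rat).
  have -> : 1 / (1 + true%:R) = 1 / 2 :> rat by [].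
  have -> : (occ n.+1 w k).+1%:R = (occ n.+1 w k)%:R + 1 :> rat.
    by rewrite natr1.
  by apply/eqP/eqP => ?; lra.
rewrite addr0 => /(outerP ic)[k [hk ek pk rk]].
move=> /(outerP ic)[k' [hk' ek' pk' rk']].
exists k, k'; split; split=> //.
  apply/eqP; rewrite -(eqr_nat rat) -natr1; apply/eqP.
  by move: pk pk'; rewrite /outer_height ek ek' -!/(occ i w _) => ? ?; lra.
have hi : (0 < i <= n.*2.+1)%N by rewrite -ek; apply: word_over_letter.
move=> l hl sl; have hl' := word_over_letter hw hl.
have [||lc adj] := side_residues_shift _ _ ic sl; [lia|lia|]; split=> //.
  by move: adj; rewrite /adjacent; apply: contraTneq => ->; lia.
rewrite (outer_height_adapted hn hw dQ ad hxi hl lc hi ic adj).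
move: pk; rewrite /outer_height ek -/(occ i w k) -(eqr_nat rat) -natr1 => pk.
by rewrite addr0 divr1; apply/eqP/eqP => ?; lra.
Qed.

(** * The two middle roots *)

(** Between two consecutive [a]'s the letters [a], [b], [c] read [c b c].  The
    mesh relation for these two [c]'s expresses the sum of their roots by the
    root of [b]. *)
Lemma middle_merge m w a b c (d : nat) k k' : word_over m w ->
  a != b -> (forall x, adjacent x c = (x == a) || (x == b)) ->
  (forall l, (l < size w)%N ->
     [|| letter w l == a, letter w l == b | letter w l == c] ->
     (occ c w l + d = occ a w l + occ b w l + (letter w l != c))%N) ->
  (k < k' < size w)%N -> letter w k = a -> letter w k' = a ->
  occ a w k' = (occ a w k).+1 -> occ b w k' = (occ b w k).+1 ->
  \sum_(k.+1 <= l < k' | letter w l == c) root_at m w l =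
  \sum_(k.+1 <= l < k' | letter w l == b) root_at m w l.
Proof.
move=> hw nab nbr alt /andP[kk' hk'] ek ek' ea eb.
have hk : (k < size w)%N by lia.
have nac : a != c by have := nbr a; rewrite eqxx /adjacent; lia.
have nbc : b != c by have := nbr b; rewrite eqxx orbT /adjacent; lia.
have bk := occ_succ b hk; rewrite ek (negbTE nab) in bk.
have ck := occ_succ c hk; rewrite ek (negbTE nac) in ck.
(* [x] is the position of [b], and [y] and [z] below those of the two [c]'s. *)
have [||x [hx lx ->]] := @one_occurrence _ (root_at m w) b w k.+1 k';
  [lia|lia|].
have bx := @occ_between a w k k' x hk hk' ek ek' ea.
have bsx : occ b w x.+1 = (occ b w x).+1.
  by rewrite occ_succ ?lx ?eqxx ?addn1 //; lia.
have csx : occ c w x.+1 = occ c w x.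
  by rewrite occ_succ ?lx ?(negbTE nbc) ?addn0 //; lia.
have b1 : (occ b w k.+1 <= occ b w x)%N by apply: occ_le; lia.
have b2 : (occ b w x.+1 <= occ b w k')%N by apply: occ_le; lia.
have ak := alt k hk; rewrite ek eqxx nac in ak; move/(_ isT) in ak.
have ak' := alt k' hk'; rewrite ek' eqxx nac in ak'; move/(_ isT) in ak'.
have ax := alt x; rewrite lx eqxx orbT nbc in ax.
have {}ax := ax (ltac:(lia)) isT.
have eax : occ a w x = (occ a w k).+1 by apply/eqP; rewrite bx; lia.
rewrite (@big_cat_nat _ _ _ x) /=; [|lia|lia].
have [||y [hy ly ->]] := @one_occurrence _ (root_at m w) c w k.+1 x; [lia|lia|].
have [||z [hz lz ->]] := @one_occurrence _ (root_at m w) c w x k'; [lia|lia|].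
have yx : (y < x)%N by lia.
have xz : (x < z)%N.
  rewrite ltn_neqAle; apply/andP; split; last by lia.
  by apply: contraNneq nbc => xz; rewrite -lx xz lz.
have csy : occ c w y.+1 = (occ c w y).+1.
  by rewrite occ_succ ?ly ?eqxx ?addn1 //; lia.
have csz : occ c w z.+1 = (occ c w z).+1.
  by rewrite occ_succ ?lz ?eqxx ?addn1 //; lia.
have c1 : (occ c w k.+1 <= occ c w y)%N by apply: occ_le; lia.
have c2 : (occ c w y.+1 <= occ c w x)%N by apply: occ_le; lia.
have c3 : (occ c w x <= occ c w z)%N by apply: occ_le; lia.
have c4 : (occ c w z.+1 <= occ c w k')%N by apply: occ_le; lia.
rewrite root_mesh //; [|lia|by rewrite ly|]; last first.
  by move=> l hl; rewrite ly; apply: (@no_occurrence c w y.+1 z); lia.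
have inside l : (k < l < k')%N -> letter w l == b -> l = x.
  move=> hl /eqP ll; have bsl : occ b w l.+1 = (occ b w l).+1.
    by rewrite occ_succ ?ll ?eqxx ?addn1 //; lia.
  have l1 : (occ b w k.+1 <= occ b w l)%N by apply: occ_le; lia.
  have l2 : (occ b w l.+1 <= occ b w k')%N by apply: occ_le; lia.
  case: (ltngtP l x) => // [lx'|xl].
    by have := occ_le b w lx'; lia.
  by have := occ_le b w xl; lia.
rewrite big_mkcond (bigD1_seq x) ?iota_uniq ?mem_index_iota /=; [|lia|done].
rewrite lx ly nbr eqxx orbT big_nat_cond big1 ?addr0 // => l /andP[hl lnx].
rewrite nbr; case: eqP => [la|_] /=.
  have : letter w l != a.
    apply: (@no_occurrence a w k.+1 k'); [lia|lia|].
    by rewrite occ_succ // ek eqxx; lia.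
  by rewrite la eqxx.
case: ifP => // /(inside l) lx'; have : l = x by apply: lx'; lia.
by move/eqP; rewrite (negbTE lnx).
Qed.

Theorem theorem6p3 (n : nat) (w : seq nat) (Q : rel nat) (xi : nat -> int)
    (i : nat) (p : rat) (alpha beta : 'rV[int]_(n.*2.+1).+1) :
  (1 <= n)%N ->
  reduced_w0 n.*2.+1 w ->
  twisted_adapted n w ->
  dynkin_quiver n.*2 Q ->
  reduced_w0 n.*2 (Pword n w) ->
  adapted Q (Pword n w) ->
  height_function Q xi ->
  beta \in pos_roots n.*2.+1 ->
  alpha \in pos_roots n.*2.+1 ->
  Omega n w xi beta (i, p) ->
  Omega n w xi alpha (i, p - 2 + (i == n.+1)%:R) ->
  beta + alpha =
    \sum_(gamma <- pos_roots n.*2.+1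
          | has (fun j => Omega n w xi gamma
                            (j, p - 1 / (1 + (i == n.+1)%:R)))
                (side_residues n i)) gamma.
Proof.
move=> hn [red _] tw dQ _ ad hxi _ _ ob oa; have hw := red.1.
have [k [k' [[hkk ek ek' ei] [<- <- sides]]]] :=
  consecutive_positions hn hw tw dQ ad hxi ob oa.
have hi : (0 < i <= n.*2.+1)%N.
  by rewrite -ek; apply: word_over_letter => //; lia.
set q := p - _ in sides *.
rewrite (sum_pos_roots (S := fun l => (letter w l \in side_residues n i) &&
    (k < l < k')%N) red); last first.
  move=> v; split=> [/hasP[j sj]|[l [hl /andP[sl kl] <-]]].
    have jc : j != n.+1.
      by move: sj; rewrite /side_residues; do 2?case: ifP; rewrite !inE; lia.
    move=> /(outerP jc)[l [hl el ql <-]]; exists l; split=> //.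
    rewrite el sj /=; have [|_ <-] := sides l hl; first by rewrite el.
    by rewrite ql.
  have [lc] := sides l hl sl; rewrite kl => /eqP <-.
  by apply/hasP; exists (letter w l) => //; apply: Omega_outer.
have -> : \sum_(0 <= l < size w | (letter w l \in side_residues n i) &&
      (k < l < k')%N) root_at n.*2.+1 w l =
    \sum_(k.+1 <= l < k' | letter w l \in side_residues n i)
      root_at n.*2.+1 w l.
  rewrite (@big_nat_widenl _ _ _ k.+1 0) //.
  rewrite (@big_nat_widen _ _ _ 0 k' (size w)).
    by apply: eq_bigl => l; rewrite andbA.
  by lia.
rewrite root_mesh //; [|by rewrite ek ek'|]; last first.
  move=> l hl; rewrite ek; apply: (@no_occurrence i w k.+1 k'); [lia|lia|].
  by rewrite occ_succ ?ek ?eqxx; lia.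
rewrite ek.
have [/orP i_mid|i_mid] := boolP ((i == n) || (i == n.+2)); last first.
  apply: eq_bigl => l; move: i_mid; rewrite /side_residues /adjacent.
  by do 2?case: ifP; rewrite !inE; lia.
(* [b] is the other one of [n] and [n+2], and [o] the outer neighbour of [i]
   (0 or 4, which is no letter, if [n = 1]). *)
pose b := if i == n then n.+2 else n.
pose o := if i == n then (n - 1)%N else (n + 3)%N.
have iE : (i = n /\ b = n.+2 /\ o = (n - 1)%N) \/
          (i = n.+2 /\ b = n /\ o = (n + 3)%N).
  rewrite /b /o; case: i_mid => /eqP ->; first by left; rewrite eqxx.
  by right; rewrite gtn_eqF.
have adjE x : adjacent x i = (x == n.+1) || (x == o) by rewrite /adjacent; lia.
have sideE x : x \in side_residues n i = (x == b) || (x == o).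
  by rewrite /side_residues; do 2?case: ifP; rewrite !inE; lia.
have e_b : occ b w k' = (occ b w k).+1.
  have height l : (l < size w)%N -> letter w l = i ->
      (xi (shift n i))%:~R - 2 * (occ i w l)%:R =
      (xi (shift n b))%:~R - 2 * (occ b w l)%:R + 1 :> rat.
    move=> hl el; rewrite -(outer_height_adapted hn hw dQ ad hxi hl) ?el //.
    - by rewrite /outer_height el.
    - lia.
    - lia.
    - lia.
    - by rewrite /adjacent /shift; do 2?case: ifP; lia.
  have hk : (k < size w)%N by lia.
  have hk' : (k' < size w)%N by lia.
  have := height k hk ek; have := height k' hk' ek'; rewrite ei -natr1 => ? ?.
  by apply/eqP; rewrite -(eqr_nat rat) -natr1; apply/eqP; lra.
rewrite (bigID (fun l => letter w l == o)).
rewrite [RHS](bigID (fun l => letter w l == o)) /=.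
congr (_ + _); first by apply: eq_bigl => l; rewrite adjE sideE; lia.
have [d hd] := middle_counts hn tw.
transitivity (\sum_(k.+1 <= l < k' | letter w l == n.+1) root_at n.*2.+1 w l).
  by apply: eq_bigl => l; rewrite adjE; lia.
rewrite (@middle_merge _ _ i b n.+1 d) //.
- by apply: eq_bigl => l; rewrite sideE; lia.
- by lia.
- by move=> x; rewrite /adjacent; lia.
move=> l hl ml; rewrite hd //; last by lia.
by case: iE => -[-> [-> _]] //; rewrite [(occ n.+2 _ _ + _)%N]addnC.
Qed.
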